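(* Let $\mathcal B$ be a BMDP such that $Q^*(q,a)<\infty$ for every type $q$ and every $a\in A(q)$, and consider the Q-learning process with learning rates $\lambda_i\in[0,1]$ satisfying $\sum_{i=0}^\infty\lambda_i=\infty$ and $\sum_{i=0}^\infty\lambda_i^2<\infty$, and a fixed selection distribution with $p_{q,a}\ge p_{\min}>0$ for all pairs. Then for every initial vector $Q_0\ge\mathbf 0$, almost surely $\lim_{i\to\infty}Q_i(q,a)=Q^*(q,a)$ for all pairs $(q,a)$; in particular $\lim_{i\to\infty}\min_{a\in A(q)}Q_i(q,a)=\mathbf c^*_q$ for every $q$.
   Context: A branching Markov decision process (BMDP) is a tuple $\mathcal B=(\mathcal T,A,p,c)$ where $\mathcal T$ is a finite set of types, $A$ is a finite set of actions, $p:\mathcal T\times A\to \mathrm{Dist}(\mathcal T^* )$ is a partial function assigning to some pairs $(q,a)$ a probability distribution with finite support over the set $\mathcal T^*$ of finite lists of types, and $c:\mathcal T\times A\to\mathbb R_{>0}$ is a strictly positive cost function. $A(q)$ is the (nonempty) set of $a$ with $p(q,a)$ defined. For a list $\alpha$, $|\alpha|$ is its length and $\alpha_i$ its $i$-th element. The BMDP induces an MDP on lists of entities: an action $(i,a)$ with $a\in A(\alpha_i)$ replaces entity $\alpha_i$ of the current list by a list $\beta$ drawn from $p(\alpha_i,a)$ at cost $c(\alpha_i,a)$; the empty list is absorbing with no cost. $\mathbf c^*_q\in[0,\infty]$ is the infimum over all (history-dependent, randomized) strategies of the expected total cost starting from the single entity $q$. Define $Q^*(q,a)=c(q,a)+\sum_{\alpha\in\mathcal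 T^*}p(q,a)(\alpha)\sum_{j=1}^{|\alpha|}\mathbf c^*_{\alpha_j}$ (so $\mathbf c^*_q=\min_{a\in A(q)}Q^*(q,a)$). Q-learning process for a BMDP: Q-values are vectors $Q$ indexed by pairs $(q,a)$ with $q\in\mathcal T$, $a\in A(q)$. Given deterministic learning rates $\lambda_i\in[0,1]$, a fixed probability distribution $(p_{q,a})$ over pairs and an initial vector $Q_0\ge\mathbf 0$, at each step $i$ a pair $(q_i,a_i)$ is selected with probability $p_{q_i,a_i}$ independently of all previous randomness, a list $\beta^i$ is drawn from $p(q_i,a_i)$ independently, and $Q_{i+1}(q_i,a_i)=(1-\lambda_i)Q_i(q_i,a_i)+\lambda_i\big(c(q_i,a_i)+\sum_{j=1}^{|\beta^i|}\min_{a'\in A(\beta^i_j)}Q_i(\beta^i_j,a')\big)$, all other entries unchanged. *)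

(* Defs.v *)
From HB Require Import structures.
From mathcomp Require Import all_boot all_order all_algebra.
From mathcomp Require Import all_classical all_reals all_analysis.
Set Implicit Arguments. Unset Strict Implicit. Unset Printing Implicit Defensive.
Import Order.TTheory GRing.Theory Num.Theory.
Local Open Scope classical_set_scope.
Local Open Scope ring_scope.

(* A BMDP over a finite set of types T and finite set of actions A.
   trans q a = None  means p(q,a) is undefined (a not in A(q));
   trans q a = Some d means p(q,a) is the finite-support distribution given by
   the list d of (outcome list, probability) entries (the probability of an
   outcome is the sum of the weights of its entries). *)
Record bmdp (R : realType) (T A : finType) := BMDP {
  trans : T -> A -> option (seq (seq T * R));
  cost : T -> A -> R
}.

Section BMDPDefs.
Variables (R : realType) (T A : finType) (B : bmdp R T A).

Definition enabled (q : T) (a : A) : bool := isSome (trans B q a).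

Definition dprob (dl : seq (seq T * R)) (beta : seq T) : R :=
  \sum_(x <- dl | x.1 == beta) x.2.

Definition bmdp_wf : Prop :=
  (forall q, exists a, enabled q a) /\
  (forall q a dl, trans B q a = Some dl ->
     (forall x, x \in dl -> 0 <= x.2) /\ \sum_(x <- dl) x.2 = 1) /\
  (forall q a, 0 < cost B q a).

(* Induced MDP on lists of entities: state = seq T, action = (i, a).
   A history is the list of past (state, action) pairs.
   A (history-dependent, randomized) strategy assigns to a history and the
   current state a weight sigma h alpha i a to each action (i, a). *)
Definition history := seq (seq T * (nat * A)).
Definition strategy := history -> seq T -> nat -> A -> R.

Definition valid_strategy (sigma : strategy) : Prop :=
  forall (h : history) (q0 : T) (alpha' : seq T),
    let alpha := q0 :: alpha' in
    (forall i a, 0 <= sigma h alpha i a) /\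
    (forall i a, 0 < sigma h alpha i a ->
        (i < size alpha)%N /\ enabled (nth q0 alpha i) a) /\
    \sum_(i < size alpha) \sum_(a : A) sigma h alpha i a = 1.

Definition replace_at (alpha : seq T) (i : nat) (beta : seq T) : seq T :=
  take i alpha ++ beta ++ drop i.+1 alpha.

Fixpoint ecost (sigma : strategy) (n : nat) (h : history) (alpha : seq T) : R :=
  match n with
  | 0 => 0
  | n'.+1 =>
    match alpha with
    | [::] => 0
    | q0 :: _ =>
      \sum_(i < size alpha) \sum_(a : A) sigma h alpha i a *
        (cost B (nth q0 alpha i) a +
         match trans B (nth q0 alpha i) a with
         | None => 0
         | Some dl => \sum_(x <- dl)
              x.2 * ecost sigma n' (rcons h (alpha, (nat_of_ord i, a)))
                                   (replace_at alpha i x.1)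
         end)
    end
  end.

(* expected total cost from the single entity q (monotone limit of the
   truncated expected costs, costs being nonnegative) *)
Definition tcost (sigma : strategy) (q : T) : \bar R :=
  ereal_sup [set (ecost sigma n [::] [:: q])%:E | n in [set: nat]].

Definition cstar (q : T) : \bar R :=
  ereal_inf [set tcost sigma q | sigma in [set s | valid_strategy s]].

Definition Qstar (q : T) (a : A) : \bar R :=
  match trans B q a with
  | None => +oo%E
  | Some dl => ((cost B q a)%:E +
       \sum_(x <- dl) (x.2)%:E * \sum_(r <- x.1) cstar r)%E
  end.

Definition minQ (Q : T -> A -> R) (q : T) : R :=
  match [pick a | enabled q a] with
  | Some a0 => \big[Num.min/Q q a0]_(a | enabled q a) Q q a
  | None => 0
  end.

(* one step of randomness: the selected pair (q,a) and the drawn list beta *)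
Definition step := (T * A * seq T)%type.

Definition stepprob (psel : T -> A -> R) (s : step) : R :=
  let: (q, a, beta) := s in
  match trans B q a with
  | None => 0
  | Some dl => psel q a * dprob dl beta
  end.

Definition qupdate (l : R) (s : step) (Q : T -> A -> R) : T -> A -> R :=
  let: (q, a, beta) := s in
  fun q' a' => if (q' == q) && (a' == a) then
       (1 - l) * Q q a + l * (cost B q a + \sum_(r <- beta) minQ Q r)
     else Q q' a'.

Fixpoint qproc (lam : nat -> R) (Q0 : T -> A -> R) (x : nat -> step) (i : nat)
  : T -> A -> R :=
  match i with
  | 0 => Q0
  | i'.+1 => qupdate (lam i') (x i') (qproc lam Q0 x i')
  end.

End BMDPDefs.

(* X is the i.i.d. sequence of step outcomes of the Q-learning process:
   every finite prefix event is measurable with the product probability *)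
Definition qlearning_law (R : realType) (T A : finType) (B : bmdp R T A)
  (psel : T -> A -> R) (d : measure_display) (Omega : measurableType d)
  (P : probability Omega R) (X : nat -> Omega -> step T A) : Prop :=
  forall s : seq (step T A),
    let E := [set w | [seq X j w | j <- iota 0 (size s)] = s] in
    measurable E /\ P E = (\prod_(x <- s) stepprob B psel x)%:E.

(* Main.v *)
Require Import Defs.
From mathcomp Require Import all_boot all_order all_algebra.
From mathcomp Require Import all_classical all_reals all_analysis.
From mathcomp Require Import ring lra.
Set Implicit Arguments. Unset Strict Implicit. Unset Printing Implicit Defensive.
Import Order.TTheory GRing.Theory Num.Theory numFieldNormedType.Exports.
Local Open Scope classical_set_scope.
Local Open Scope ring_scope.

(* The optimal cost vector [u] is the largest subsolution of the Bellman equation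
   [u q = min_a (c q a + sum_b p(b) sum_j u b_j)].  A subsolution [w] lies below
   the cost of every strategy: the potential of the list after [n] steps is at
   most a constant times the cost still to be paid, which tends to 0 when the total cost is
   finite; conversely the greedy policy, applied to the leftmost entity, costs at
   most [u].

   Since costs are bounded below by a positive multiple of Q*, the Bellman
   operator [G] contracts towards Q* in the maximum norm weighted by Q*, although
   it need not contract between arbitrary points.  Replacing this norm by an
   l^N norm with [N] even and large gives a smooth Lyapunov function [V] with
     E V(Q_{i+1}) <= (1 + b lam_i^2) V(Q_i) - a lam_i V(Q_i) + b lam_i^2.
   Multiplying [1 + V] by the exponential of the tail of the series of the
   [b lam_i^2] yields a nonnegative supermartingale whose expectation tends to 0,
   because the [lam_i] have infinite sum, and the maximal inequality turns this
   into almost sure convergence. *)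

(** * Bellman equation for the list process *)

Section ListMDP.
Variables (R : realType) (T A : finType) (B : bmdp R T A).
Hypothesis HB : bmdp_wf B.

Definition outs (q : T) (a : A) : seq (seq T * R) := odflt [::] (trans B q a).

Definition eout (q : T) (a : A) (f : seq T -> R) : R :=
  \sum_(x <- outs q a) x.2 * f x.1.

Definition Qof (w : T -> R) (q : T) (a : A) : R :=
  cost B q a + eout q a (fun b => \sum_(r <- b) w r).

Lemma outs_ge0 q a x : x \in outs q a -> 0 <= x.2.
Proof.
case: HB => _ [H _]; rewrite /outs; case E: (trans B q a) => [dl|] //=.
by have [+ _] := H _ _ _ E; apply.
Qed.

Lemma eout_cst q a c : enabled B q a -> eout q a (fun=> c) = c.
Proof.
case: HB => _ [H _]; rewrite /enabled /eout /outs.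
case E: (trans B q a) => [dl|] //= _.
by have [_ s1] := H _ _ _ E; rewrite -mulr_suml s1 mul1r.
Qed.

Lemma eout_le q a f g :
  (forall x, x \in outs q a -> f x.1 <= g x.1) -> eout q a f <= eout q a g.
Proof.
move=> fg; rewrite /eout big_seq [leRHS]big_seq; apply: ler_sum => x xin.
by apply: ler_wpM2l; [exact: outs_ge0 xin | exact: fg].
Qed.

Lemma eq_eout q a f g : f =1 g -> eout q a f = eout q a g.
Proof. by move=> fg; apply: eq_bigr => x _; rewrite fg. Qed.

Lemma eoutD q a f g : eout q a (fun b => f b + g b) = eout q a f + eout q a g.
Proof. by rewrite /eout -big_split; apply: eq_bigr => x _; rewrite mulrDr. Qed.

Lemma eoutZ q a c f : eout q a (fun b => c * f b) = c * eout q a f.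
Proof. by rewrite /eout mulr_sumr; apply: eq_bigr => x _; rewrite mulrCA. Qed.

Lemma Qof_le w w' q a : (forall r, w r <= w' r) -> Qof w q a <= Qof w' q a.
Proof.
by move=> ww'; rewrite lerD2l; apply: eout_le => x _; apply: ler_sum.
Qed.

Lemma minQ_le Q q a : enabled B q a -> minQ B Q q <= Q q a.
Proof.
move=> qa; rewrite /minQ; case: pickP => [a0 qa0|/(_ a)]; last by rewrite qa.
exact: (bigmin_le_cond _ _ qa).
Qed.

Lemma minQ_attained Q q : exists2 a, enabled B q a & minQ B Q q = Q q a.
Proof.
have [/(_ q)[a qa] _] := HB.
rewrite /minQ; case: pickP => [a0 qa0|/(_ a)]; last by rewrite qa.
elim/big_ind: _ => [|x y [a1 q1 ->] [a2 q2 ->]|a1 q1].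
- by exists a0.
- by rewrite /Num.min; case: ifP => _; [exists a1|exists a2].
- by exists a1.
Qed.

Lemma size_replace (al : seq T) i b : (i < size al)%N ->
  size (replace_at al i b) = ((size al).-1 + size b)%N.
Proof.
move=> ial; rewrite /replace_at !size_cat size_take ial size_drop.
by rewrite addnCA addnC; congr addn; rewrite -[in RHS](subnKC ial) addSn.
Qed.

Lemma sum_replace (w : T -> R) q0 (al : seq T) i b : (i < size al)%N ->
  \sum_(r <- replace_at al i b) w r =
  \sum_(r <- al) w r - w (nth q0 al i) + \sum_(r <- b) w r.
Proof.
move=> ial; rewrite /replace_at !big_cat /=.
rewrite -[in \sum_(r <- al) _](cat_take_drop i al) (drop_nth q0 ial).
by rewrite big_cat big_cons /=; lra.
Qed.

(** * Truncated costs and expected potentials under a fixed strategy *)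

Section Strategy.
Variable sg : strategy R T A.
Hypothesis Hsg : valid_strategy B sg.

Definition avg (h : history T A) (al : seq T) (f : nat -> A -> R) : R :=
  \sum_(i < size al) \sum_(a : A) sg h al i a * f i a.

(** A valid strategy gives positive weight only to enabled actions on existing entities, so the
    comparison is needed there alone. *)
Lemma avg_le h q0 al' f g : let al := q0 :: al' in
  (forall i a, (i < size al)%N -> enabled B (nth q0 al i) a -> f i a <= g i a) ->
  avg h al f <= avg h al g.
Proof.
move=> al fg; apply: ler_sum => i _; apply: ler_sum => a _.
have [p0 [pe _]] := Hsg h q0 al'; have := p0 i a.
rewrite le_eqVlt => /predU1P[<-|p]; first by rewrite !mul0r.
by rewrite ler_pM2l//; apply: fg; have [] := pe _ _ p.
Qed.

Lemma avg_cst h q0 al' c : avg h (q0 :: al') (fun _ _ => c) = c.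
Proof.
have [_ [_ s1]] := Hsg h q0 al'; rewrite /avg.
under eq_bigr do rewrite -mulr_suml.
by rewrite -mulr_suml s1 mul1r.
Qed.

Lemma avgD h al f g :
  avg h al (fun i a => f i a + g i a) = avg h al f + avg h al g.
Proof.
rewrite /avg -big_split; apply: eq_bigr => i _ /=; rewrite -big_split.
by apply: eq_bigr => a _; rewrite mulrDr.
Qed.

Lemma avgZ h al c f : avg h al (fun i a => c * f i a) = c * avg h al f.
Proof.
rewrite /avg mulr_sumr; apply: eq_bigr => i _; rewrite mulr_sumr.
by apply: eq_bigr => a _; rewrite mulrCA.
Qed.

Definition next (h : history T A) al (i : nat) (a : A) : history T A :=
  rcons h (al, (i, a)).

Lemma ecostS n h q0 al' : let al := q0 :: al' in
  ecost B sg n.+1 h al = avg h al (fun i a => cost B (nth q0 al i) a +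
    eout (nth q0 al i) a
      (fun b => ecost B sg n (next h al i a) (replace_at al i b))).
Proof.
move=> al; apply: eq_bigr => i _; apply: eq_bigr => a _.
congr (_ * (_ + _)); rewrite /eout /outs /=.
by case: trans => [dl|] //=; rewrite big_nil.
Qed.

Lemma ecost_nil n h : ecost B sg n h [::] = 0. Proof. by case: n. Qed.

(** Expectation of the additive potential [w] of the list reached after [n] steps of [sg]; the
    absorbing empty list has potential 0. *)
Fixpoint epot (w : T -> R) n h al : R :=
  if n isn't n'.+1 then \sum_(r <- al) w r else
  if al isn't q0 :: _ then 0 else
  avg h al (fun i a => eout (nth q0 al i) a
      (fun b => epot w n' (next h al i a) (replace_at al i b))).

Lemma epotS w n h q0 al' : let al := q0 :: al' in
  epot w n.+1 h al = avg h al (fun i a => eout (nth q0 al i) a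
      (fun b => epot w n (next h al i a) (replace_at al i b))).
Proof. by []. Qed.

Lemma epot_nil w n h : epot w n h [::] = 0.
Proof. by case: n => //=; rewrite big_nil. Qed.

Lemma cost_gt0 q a : 0 < cost B q a. Proof. by have [_ [_]] := HB. Qed.

Lemma ecost_ge0 n h al : 0 <= ecost B sg n h al.
Proof.
elim: n h al => [|n IH] h [|q0 al'] //; rewrite ecostS.
rewrite -[leLHS](avg_cst h q0 al' 0); apply: avg_le => i a _ qa.
apply: addr_ge0 (ltW (cost_gt0 _ _)) _; rewrite -[leLHS](eout_cst 0 qa).
by apply: eout_le => x _; apply: IH.
Qed.

(** A step removes at most one entity, so a list of at least [s] entities stays nonempty for [s]
    steps, each costing at least [cmin]. *)
Lemma ecost_ge_size cmin m s h al : (forall q a, cmin <= cost B q a) ->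
  0 <= cmin -> (s <= m)%N -> (s <= size al)%N -> cmin * s%:R <= ecost B sg m h al.
Proof.
move=> cm c0; elim: m s h al => [|m IH] [|s] h [|q0 al'] // sm sal;
  rewrite ?ecost_nil ?mulr0 //.
  exact: ecost_ge0.
rewrite ecostS -[leLHS](avg_cst h q0 al'); apply: avg_le => i a ial qa.
rewrite -natr1 mulrDr mulr1 addrC; apply: lerD (cm _ _) _.
rewrite -[leLHS](eout_cst (cmin * s%:R) qa); apply: eout_le => x _.
by apply: IH => //; rewrite size_replace//=; apply: leq_trans (leq_addr _ _).
Qed.

(** Induction on the horizon: by the subsolution inequality, a step lowers the expected potential by
    at most its expected cost. *)
Lemma subsolution_le w n h al : (forall r a, enabled B r a -> w r <= Qof w r a) ->
  \sum_(r <- al) w r <= ecost B sg n h al + epot w n h al.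
Proof.
move=> wQ; elim: n h al => [|n IH] h [|q0 al'];
  rewrite ?epot_nil ?ecost_nil ?big_nil ?addr0 //; first by rewrite add0r.
rewrite ecostS epotS -avgD -[leLHS](avg_cst h q0 al'); apply: avg_le => i a ial qa.
rewrite -addrA -eoutD; set al := q0 :: al'; set q := nth q0 al i.
have: cost B q a + eout q a (fun b => \sum_(r <- replace_at al i b) w r) <=
  cost B q a + eout q a (fun b => ecost B sg n (next h al i a) (replace_at al i b)
     + epot w n (next h al i a) (replace_at al i b)).
  by rewrite lerD2l; apply: eout_le => x _; apply: IH.
apply: le_trans.
rewrite (eq_eout _ _ (fun b => sum_replace w q0 b ial)) eoutD eout_cst//.
by have := wQ _ _ qa; rewrite /Qof -/q; lra.
Qed.

(* Each of the entities alive after [n] steps costs at least [cmin] later on. *)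
Lemma epot_le_remaining w cmin th bmax n M h al :
  (forall q a, cmin <= cost B q a) -> 0 <= cmin ->
  (forall r, th * w r <= cmin) ->
  (forall q a x, x \in outs q a -> (size x.1 <= bmax)%N) ->
  (size al + n * bmax <= M)%N ->
  ecost B sg n h al + th * epot w n h al <= ecost B sg (n + M) h al.
Proof.
move=> cm c0 thw bm; elim: n h al => [|n IH] h [|q0 al'] hM;
  rewrite ?epot_nil ?ecost_nil ?mulr0 ?addr0 //.
  (* [M] bounds the size of the list after [n] steps, so [M] further steps suffice to charge [cmin]
     to each entity left. *)
  rewrite add0r add0n [leLHS]/= mulr_sumr.
  apply: le_trans (ecost_ge_size h cm c0 (leq_trans (leq_addr _ _) hM) (leqnn _)).
  rewrite mulr_natr -iter_addr_0 -count_predT -big_const_seq.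
  exact: ler_sum.
rewrite addSn !ecostS epotS -avgZ -avgD; apply: avg_le => i a ial qa.
rewrite -addrA lerD2l -eoutZ -eoutD; apply: eout_le => x xin.
apply: IH; apply: leq_trans hM; rewrite size_replace// mulSn addnA leq_add2r.
by apply: leq_add (leq_pred _) (bm _ _ _ xin).
Qed.

End Strategy.

(** * The optimal cost as the largest subsolution *)

Lemma cost_lbound : exists2 c : R, 0 < c & forall q a, c <= cost B q a.
Proof.
exists (\big[Num.min/1]_(k : T * A) cost B k.1 k.2).
  by apply: lt_bigmin => // k _; exact: cost_gt0.
by move=> q a; exact: (bigmin_le _ (q, a)).
Qed.

Lemma size_outs_ubound :
  exists n, forall q a x, x \in outs q a -> (size x.1 <= n)%N.
Proof.
exists (\max_(k : T * A) \max_(x <- outs k.1 k.2) size x.1) => q a x xin.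
apply: leq_trans (leq_bigmax (q, a)) => /=.
exact: (@leq_bigmax_seq _ _ xpredT (fun x : seq T * R => size x.1) _ xin).
Qed.

Lemma fun_ubound (I : finType) (w : I -> R) : exists2 W, 0 < W & forall r, w r <= W.
Proof.
exists (\big[Num.max/1]_i w i); last by move=> r; exact: le_bigmax.
by apply: lt_le_trans (bigmax_ge_id _ _ _ _); rewrite ltr01.
Qed.

Definition subsolution (w : T -> R) :=
  forall r a, enabled B r a -> w r <= Qof w r a.

(** If [w q] exceeded a finite total cost [K], the expected potential would always be at least
    [w q - K]. Every horizon could then be extended to one costing [th * (w q - K)] more, and
    finitely many extensions would exceed [K]. *)
Lemma subsolution_le_tcost w sg q : subsolution w -> valid_strategy B sg ->
  ((w q)%:E <= tcost B sg q)%E.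
Proof.
move=> wS Hsg; set K := tcost B sg q.
have eK n : ((ecost B sg n [::] [:: q])%:E <= K)%E.
  by apply: ereal_sup_ubound; exists n.
case: K eK => [K||] eK; [|by rewrite leey|by have := eK 0%N].
rewrite lee_fin leNgt; apply/negP => Kw.
have [c c0 cle] := cost_lbound; have [W W0 wW] := fun_ubound w.
(* Costs are at least [c] and [w] is at most [W], so a single cost pays for [th] times the potential
   of an entity. *)
have [b hb] := size_outs_ubound; pose th := c / W.
have th0 : 0 < th by rewrite divr_gt0.
have thw r : th * w r <= c.
  by rewrite /th mulrAC ler_pdivrMr// ler_pM2l.
have step n : exists m,
    ecost B sg n [::] [:: q] + th * (w q - K) <= ecost B sg m [::] [:: q].
  exists (n + (1 + n * b))%N.
  apply: le_trans (_ : ecost B sg n [::] [:: q] + th * epot sg w n [::] [:: q] <= _).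
    2: exact: epot_le_remaining cle (ltW c0) thw hb (leqnn _).
  rewrite lerD2l ler_pM2l//; have := subsolution_le Hsg n [::] [:: q] wS.
  by rewrite big_seq1; have := eK n; rewrite lee_fin; lra.
have steps k : exists n, (th * (w q - K)) *+ k <= ecost B sg n [::] [:: q].
  elim: k => [|k [n hn]]; first by exists 0%N.
  have [m hm] := step n; exists m; rewrite mulrS addrC.
  by apply: le_trans hm; rewrite lerD2r.
have d0 : 0 < th * (w q - K) by rewrite mulr_gt0// subr_gt0.
have [k] := steps (Num.truncn (K / (th * (w q - K)))).+1.
move=> h1; have := eK k; rewrite lee_fin => /(le_trans h1).
by rewrite leNgt -mulr_natl -ltr_pdivrMr// truncnS_gt.
Qed.

Definition leftmost (pi : T -> A) : strategy R T A := fun _ al i a =>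
  if al is q0 :: _ then ((i == 0%N) && (a == pi q0))%:R else 0.

Lemma leftmost_valid pi : (forall q, enabled B q (pi q)) ->
  valid_strategy B (leftmost pi).
Proof.
move=> pie h q0 al'; split => [i a|]; first exact: ler0n.
split => [i a|].
  by rewrite /= ltr0n lt0b => /andP[/eqP-> /eqP->].
rewrite /= big_ord_recl (bigD1 (pi q0))//= eqxx big1 ?addr0.
  by rewrite big1 ?addr0// => i _; rewrite big1.
by move=> a /negbTE ->.
Qed.

(** The potential of the first entity pays for its cost and for the potential of its offspring,
    while the other entities carry over unchanged. *)
Lemma ecost_leftmost_le w pi n h al : (forall r, 0 <= w r) ->
  (forall q, enabled B q (pi q)) -> (forall q, Qof w q (pi q) <= w q) ->
  ecost B (leftmost pi) n h al <= \sum_(r <- al) w r.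
Proof.
move=> w0 pie pw; have V := leftmost_valid pie.
have s0 al1 : 0 <= \sum_(r <- al1) w r by apply: sumr_ge0.
elim: n h al => [|n IH] h al; first exact: s0.
case: al => [|q0 al']; first by rewrite ecost_nil.
rewrite ecostS /avg big_ord_recl (bigD1 (pi q0))//= eqxx mul1r.
rewrite big1 ?addr0 => [|a /negbTE->]; last by rewrite mul0r.
rewrite big1 ?addr0 => [|i _]; last by rewrite big1// => a _; rewrite mul0r.
rewrite big_cons; apply: le_trans (lerD (pw q0) (lexx _)).
rewrite /Qof -addrA lerD2l -[X in _ + X](eout_cst _ (pie q0)) -eoutD.
apply: eout_le => x _; apply: le_trans (IH _ _) _.
by rewrite /replace_at take0 /= drop0 big_cat.
Qed.

Lemma bellman :
  (forall q a, enabled B q a -> (Qstar B q a < +oo)%E) ->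
  exists u : T -> R, [/\ forall q, 0 <= u q,
    forall q, cstar B q = (u q)%:E,
    forall q a, enabled B q a -> Qstar B q a = (Qof u q a)%:E &
    forall q, minQ B (Qof u) q = u q].
Proof.
move=> Qfin.
have QstarE (w : T -> R) q a : enabled B q a ->
    (Qof w q a)%:E = ((cost B q a)%:E +
      \sum_(x <- outs q a) (x.2)%:E * \sum_(r <- x.1) (w r)%:E)%E.
  move=> _; rewrite /Qof EFinD /eout -sumEFin; congr (_ + _)%E.
  by apply: eq_bigr => x _; rewrite EFinM sumEFin.
have Qstar_outs q a : enabled B q a -> Qstar B q a = ((cost B q a)%:E +
      \sum_(x <- outs q a) (x.2)%:E * \sum_(r <- x.1) cstar B r)%E.
  by rewrite /Qstar /outs /enabled; case: trans.
have subQ w q a : subsolution w -> enabled B q a -> ((Qof w q a)%:E <= Qstar B q a)%E.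
  move=> wS qa; rewrite QstarE// Qstar_outs//; apply: leeD => //.
  rewrite big_seq [leRHS]big_seq; apply: lee_sum => x xin.
  apply: lee_wpmul2l; first by rewrite lee_fin (outs_ge0 xin).
  apply: lee_sum => r _; apply: le_ereal_inf_tmp => _ [sg Hsg <-].
  exact: subsolution_le_tcost.
(* [subQ] and the finiteness of [Qstar] bound all subsolutions, and 0 is one of them, so the
   pointwise supremum is real. *)
pose S := [set w | subsolution w]; pose u q := sup [set w q | w in S].
have S0 : S (fun=> 0).
  move=> r a ra; rewrite /Qof (eq_eout _ _ (g := fun=> 0)) ?eout_cst ?addr0.
  - exact/ltW/cost_gt0.
  - by [].
  - by move=> b; rewrite big1.
have Ssup q : has_sup [set w q | w in S].
  split; first by exists 0; exists (fun=> 0).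
  have [/(_ q) [a qa] _] := HB.
  exists (fine (Qstar B q a)) => _ [w wS <-].
  apply: le_trans (wS _ _ qa) _; have := subQ _ _ _ wS qa.
  by case: (Qstar B q a) (Qfin _ _ qa) => //= x; rewrite lee_fin.
have leu w q : subsolution w -> w q <= u q.
  by move=> wS; apply: ub_le_sup; [exact: (Ssup q).2 | exists w].
have uS : subsolution u.
  move=> r a ra; apply: ge_sup; first exact: (Ssup r).1.
  move=> _ [w wS <-]; apply: le_trans (wS _ _ ra) _.
  by apply: Qof_le => s; exact: leu.
have u0 q : 0 <= u q by exact: (leu _ _ S0).
have uF q : u q <= minQ B (Qof u) q.
  by have [a qa ->] := minQ_attained (Qof u) q; exact: uS.
(* Since [Qof] is monotone and [u] lies below its Bellman image, that image is again a subsolution;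
   maximality of [u] gives the reverse inequality. *)
have Fu q : minQ B (Qof u) q = u q.
  apply/eqP; rewrite eq_le uF andbT; apply: leu => r a ra.
  by apply: le_trans (minQ_le _ ra) _; exact: Qof_le.
have [pi Hpi] : exists pi : T -> A, forall q,
    enabled B q (pi q) /\ minQ B (Qof u) q = Qof u q (pi q).
  suff /boolp.choice[pi] : forall q, exists a,
    enabled B q a /\ minQ B (Qof u) q = Qof u q a by exists pi.
  by move=> q; have [a] := minQ_attained (Qof u) q; exists a.
have cE q : cstar B q = (u q)%:E.
  apply/eqP; rewrite eq_le; apply/andP; split; last first.
    by apply: le_ereal_inf_tmp => _ [sg Hsg <-]; exact: subsolution_le_tcost.
  have pie r : enabled B r (pi r) by have [] := Hpi r.
  apply: le_trans (_ : tcost B (leftmost pi) q <= _)%E.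
    by apply: ereal_inf_lbound; exists (leftmost pi) => //; exact: leftmost_valid.
  apply: ge_ereal_sup => _ [n _ <-]; rewrite lee_fin.
  rewrite -[leRHS](big_seq1 +%R q u); apply: ecost_leftmost_le => // r.
  by have [_ <-] := Hpi r; rewrite Fu.
exists u; split => // q a qa; rewrite QstarE// Qstar_outs//.
congr (_ + _)%E; apply: eq_bigr => x _; congr (_ * _)%E.
by apply: eq_bigr => r _; rewrite cE.
Qed.

End ListMDP.

(** * Supermartingales driven by i.i.d. discrete steps *)

Section Driven.
Variables (R : realType) (S : countType) (mu : S -> R) (supp : seq S).
Hypothesis supp_uniq : uniq supp.
Hypothesis mu_sum1 : \sum_(s <- supp) mu s = 1.
Variables (d : measure_display) (Omega : measurableType d) (P : probability Omega R).
Variable X : nat -> Omega -> S.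

Definition prefix (w : Omega) (n : nat) : seq S := [seq X j w | j <- iota 0 n].

Definition cyl (s : seq S) : set Omega := [set w | prefix w (size s) = s].

Hypothesis HX : forall s, measurable (cyl s) /\ P (cyl s) = (\prod_(x <- s) mu x)%:E.

Let mcyl s : measurable (cyl s) := (HX s).1.

Lemma size_prefix w n : size (prefix w n) = n.
Proof. by rewrite size_map size_iota. Qed.

Lemma prefixS w n : prefix w n.+1 = rcons (prefix w n) (X n w).
Proof. by rewrite /prefix -addn1 iotaD map_cat cats1. Qed.

(** There are countably many prefixes, so an event they determine is a countable union of
    cylinders. *)
Lemma measurable_prefix n (D : set (seq S)) : measurable [set w | D (prefix w n)].
Proof.
rewrite (_ : [set _ | _] =
    \bigcup_s if `[< size s = n /\ D s >] then cyl s else set0).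
  apply: countable_bigcupT_measurable => [|s]; first exact: countableP.
  by case: ifP.
apply/seteqP; split => w /=.
  move=> Dw; exists (prefix w n) => //.
  case: asboolP => [_|[]]; last by rewrite size_prefix.
  by rewrite /cyl /= size_prefix.
move=> [s _]; case: asboolP => // -[sn Ds].
by rewrite /cyl /= sn => ->.
Qed.

Definition pr (E : set Omega) : R := fine (P E).

Lemma prE E : measurable E -> P E = (pr E)%:E.
Proof. by move=> mE; rewrite /pr fineK// fin_num_measure. Qed.

Lemma pr_ge0 E : 0 <= pr E. Proof. exact/fine_ge0/measure_ge0. Qed.

Lemma pr_le E F : measurable E -> measurable F -> E `<=` F -> pr E <= pr F.
Proof.
by move=> mE mF EF; rewrite -lee_fin -!prE// le_measure// inE.
Qed.

Lemma prDI E C : measurable E -> measurable C ->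
  pr E = pr (E `\` C) + pr (E `&` C).
Proof.
move=> mE mC; apply: EFin_inj; rewrite EFinD -!prE//.
- by rewrite (measureDI P mE mC).
- exact: measurableI.
- exact: measurableD.
Qed.

Lemma pr_cyl s : pr (cyl s) = \prod_(x <- s) mu x.
Proof. by rewrite /pr (HX s).2. Qed.

Lemma mu_ge0 s : 0 <= mu s.
Proof. by rewrite -(big_seq1 *%R s mu) -pr_cyl pr_ge0. Qed.

Lemma pr_cyl_ge0 s : 0 <= \prod_(x <- s) mu x.
Proof. by rewrite -pr_cyl pr_ge0. Qed.

(** Finite additivity over disjoint pieces of [E]; the last term is the mass they leave uncovered,
    which bounds the rest of [D] in [E]. *)
Lemma pr_cover_le (I : eqType) (ss : seq I) (C : I -> set Omega) (E D : set Omega) :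
  uniq ss -> measurable E -> measurable D -> (forall i, measurable (C i)) ->
  (forall i, C i `<=` E) -> (forall i j, i != j -> C i `&` C j = set0) ->
  pr (E `&` D) <=
    \sum_(i <- ss) pr (C i `&` D) + (pr E - \sum_(i <- ss) pr (C i)).
Proof.
elim: ss C E => [|i ss IH] C E; rewrite /= ?big_nil.
  by move=> *; rewrite subr0 add0r pr_le//; exact: measurableI.
move=> /andP[iss uss] mE mD mC CE Ctriv; rewrite !big_cons.
have mEC : measurable (E `\` C i) by exact: measurableD.
(* Emptying the piece [i] puts the whole family inside what remains of [E]; the sums over [ss] do
   not change, as [i] is not in [ss]. *)
pose C' j := if j == i then set0 else C j.
have eqC (G : set Omega -> R) : \sum_(j <- ss) G (C' j) = \sum_(j <- ss) G (C j).
  apply: eq_big_seq => j jss; rewrite /C'; case: eqP => // ji.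
  by rewrite -ji jss in iss.
have := IH C' (E `\` C i) uss mEC mD; rewrite (eqC (fun A => pr (A `&` D))) (eqC pr).
have -> : pr (E `&` D) = pr ((E `\` C i) `&` D) + pr (C i `&` D).
  rewrite (@prDI (E `&` D) (C i)) //; last exact: measurableI.
  by rewrite setIAC (setIidr (CE i)) !setDE setIAC.
have -> : pr (E `\` C i) = pr E - pr (C i).
  by rewrite (@prDI E (C i))// (setIidr (CE i)) addrK.
move=> H; suff : pr ((E `\` C i) `&` D) <= \sum_(j <- ss) pr (C j `&` D) +
    (pr E - pr (C i) - \sum_(j <- ss) pr (C j)) by lra.
apply: H.
- by move=> j; rewrite /C'; case: eqP.
- move=> j w; rewrite /C'; case: eqP => [_ []|/eqP ji Cj]; split; first exact: CE Cj.
  by move=> Ci; rewrite -[False]/(set0 w) -(Ctriv j i).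
- move=> j k jk; rewrite /C'; case: eqP => _; first by rewrite set0I.
  by case: eqP => _; [rewrite setI0|exact: Ctriv].
Qed.

(** The extensions of [s] along [supp] need not cover [cyl s], but their masses add up to its mass,
    so the remainder is null. *)
Lemma cyl_split s D : measurable D ->
  pr (cyl s `&` D) <= \sum_(x <- supp) pr (cyl (rcons s x) `&` D).
Proof.
move=> mD; have := @pr_cover_le _ supp (fun x => cyl (rcons s x)) (cyl s) D
  supp_uniq (mcyl s) mD (fun x => mcyl _).
have -> : \sum_(x <- supp) pr (cyl (rcons s x)) = pr (cyl s).
  by under eq_bigr do rewrite pr_cyl big_rcons/=; rewrite -mulr_sumr mu_sum1 mulr1 pr_cyl.
rewrite subrr addr0; apply.
- by move=> x w; rewrite /cyl /= size_rcons prefixS => /rcons_inj[].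
- move=> x y xy; apply/seteqP; split => // w [].
  rewrite /cyl /= !size_rcons prefixS => /rcons_inj[_ Xx] /rcons_inj[_ Xy].
  by rewrite -Xx -Xy eqxx in xy.
Qed.

Definition estep (f : S -> R) : R := \sum_(s <- supp) mu s * f s.

Lemma estep_le f g : (forall s, f s <= g s) -> estep f <= estep g.
Proof. by move=> fg; apply: ler_sum => s _; apply: ler_wpM2l => //; exact: mu_ge0. Qed.

Lemma estep_affine c e f : estep (fun s => c * f s + e) = c * estep f + e.
Proof.
rewrite /estep; under eq_bigr do rewrite mulrDr mulrCA.
by rewrite big_split /= -mulr_sumr -mulr_suml mu_sum1 mul1r.
Qed.

(** * Maximal inequality and convergence for a chain driven by the steps *)

Section Chain.
Variables (St : Type) (upd : S -> St -> St) (st0 : St) (Inv : St -> Prop).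
Hypothesis Inv0 : Inv st0.
Hypothesis InvS : forall s st, Inv st -> Inv (upd s st).

Definition run (s : seq S) : St := foldl (fun st x => upd x st) st0 s.

Lemma run_rcons s x : run (rcons s x) = upd x (run s).
Proof. by rewrite /run -cats1 foldl_cat. Qed.

Lemma Inv_run s : Inv (run s).
Proof.
by elim/last_ind: s => [//|s x IH]; rewrite run_rcons; exact: InvS.
Qed.

(** Expectation of [f] at the state reached after [k] steps, written as nested finite sums instead
    of an integral over [Omega]. *)
Fixpoint eiter k (f : St -> R) (st : St) : R :=
  if k isn't k'.+1 then f st else estep (fun s => eiter k' f (upd s st)).

Lemma eiterSr k f st :
  eiter k.+1 f st = eiter k (fun st => estep (fun s => f (upd s st))) st.
Proof.
elim: k st => [//|k IH] st; apply: eq_bigr => s _.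
by congr (_ * _); exact: IH.
Qed.

Lemma eiter_affine k c e f st :
  eiter k (fun st => c * f st + e) st = c * eiter k f st + e.
Proof.
elim: k st => [//|k IH] st /=; rewrite -estep_affine.
by apply: eq_bigr => s _; rewrite IH.
Qed.

(** Backward induction: bounds on the cylinders of length [n] average, one step at a time, into
    bounds on shorter ones. *)
Lemma cyl_le_eiter D g n k s : measurable D ->
  (forall s, size s = n -> pr (cyl s `&` D) <= (\prod_(x <- s) mu x) * g (run s)) ->
  (size s + k)%N = n ->
  pr (cyl s `&` D) <= (\prod_(x <- s) mu x) * eiter k g (run s).
Proof.
move=> mD Dg; elim: k s => [|k IH] s; first by rewrite addn0; exact: Dg.
move=> sk; apply: le_trans (cyl_split s mD) _; rewrite /= /estep mulr_sumr.
apply: ler_sum => x _; rewrite mulrA -big_rcons -run_rcons.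
by apply: IH; rewrite size_rcons addSnnS.
Qed.

Variable W : St -> R.
Hypothesis W_ge0 : forall st, Inv st -> 0 <= W st.
Hypothesis W_super : forall st, Inv st -> estep (fun s => W (upd s st)) <= W st.

Definition hit (eps : R) (n N : nat) : set Omega :=
  [set w | exists2 j, (j <= N)%N & eps <= W (run (prefix w (n + j)))].

Lemma measurable_hit eps n N : measurable (hit eps n N).
Proof.
rewrite (_ : hit eps n N = \bigcup_(j in [set j | (j <= N)%N])
    [set w | eps <= W (run (prefix w (n + j)))]).
  apply: bigcup_measurable => j _.
  exact: (measurable_prefix _ (fun s => eps <= W (run s))).
by apply/seteqP; split => w [j]; exists j.
Qed.

(** Maximal inequality conditional on the prefix [s], by induction on the window. If [W] has reached
    [eps] at [s], the right side is at least the mass of the cylinder; otherwise the hit comes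
    later, and averaging over the next step uses the supermartingale property. *)
Lemma cyl_maximal eps N s : 0 < eps ->
  pr (cyl s `&` hit eps (size s) N) <= (\prod_(x <- s) mu x) * (W (run s) / eps).
Proof.
move=> e0; elim: N s => [|N IH] s;
  (have [Ws|Ws] := leP eps (W (run s));
  [by apply: (@le_trans _ _ (pr (cyl s)));
    [apply: pr_le => //; apply: measurableI => //; exact: measurable_hit
    |rewrite pr_cyl ler_peMr ?pr_cyl_ge0// ler_pdivlMr// mul1r]|]).
  rewrite (_ : _ `&` _ = set0) /pr ?measure0.
    by rewrite mulr_ge0 ?pr_cyl_ge0// divr_ge0 ?(ltW e0)//; apply/W_ge0/Inv_run.
  apply/seteqP; split => // w [/= ws [[|//] _]].
  by rewrite addn0 ws leNgt Ws.
apply: le_trans (cyl_split s (measurable_hit _ _ _)) _.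
apply: (@le_trans _ _
    ((\prod_(x <- s) mu x) * (estep (fun x => W (upd x (run s))) / eps))); last first.
  apply: ler_wpM2l; first exact: pr_cyl_ge0.
  by rewrite ler_pM2r ?invr_gt0//; apply/W_super/Inv_run.
rewrite /estep mulr_suml mulr_sumr; apply: ler_sum => x _.
rewrite -mulrA mulrA -big_rcons -run_rcons; apply: le_trans (IH (rcons s x)).
apply: pr_le; [| |move=> w [ws]].
- by apply: measurableI => //; exact: measurable_hit.
- by apply: measurableI => //; exact: measurable_hit.
(* Offset 0 would be a hit at [s] itself, excluded by [Ws]; offset [j.+1] from [s] is offset [j]
   from [rcons s x]. *)
move=> [[|j] jN]; rewrite ?addn0.
  have -> : prefix w (size s) = s.
    by move: ws; rewrite /cyl /= size_rcons prefixS => /rcons_inj[].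
  by rewrite leNgt Ws.
by move=> ej; split => //; exists j; rewrite // size_rcons addSnnS.
Qed.

Lemma maximal eps n N : 0 < eps -> pr (hit eps n N) <= eiter n W st0 / eps.
Proof.
move=> e0; have mh := measurable_hit eps n N.
have := @cyl_le_eiter (hit eps n N) (fun st => W st / eps) n n [::] mh.
rewrite big_nil mul1r (_ : cyl [::] = setT) ?setTI; last first.
  by apply/seteqP; split.
move=> /(_ _ erefl) H; apply: le_trans (H _) _; last first.
  have := eiter_affine n eps^-1 0 W st0; rewrite addr0 [in leRHS]mulrC => <-.
  rewrite le_eqVlt; apply/orP; left; apply/eqP; congr eiter.
  by apply/funext => st; rewrite addr0 mulrC.
by move=> s <-; exact: cyl_maximal.
Qed.

(** For a fixed level [eps], the event of reaching it after every time [n] has probability at most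
    [eiter n W st0 / eps] for all [n], hence is null; countably many levels suffice. *)
Lemma supermartingale_cvg0 :
  (forall e : R, 0 < e -> exists n, eiter n W st0 <= e) ->
  {ae P, forall w, forall e : R, 0 < e ->
     exists n, forall j, (n <= j)%N -> W (run (prefix w j)) < e}.
Proof.
move=> Wsmall.
suff H : {ae P, forall w, forall k : nat,
     exists n, forall j, W (run (prefix w (n + j))) < k.+1%:R^-1}.
  apply: filterS H => w H e e0; have [n hn] := H (Num.truncn e^-1).
  exists n => j nj; have := hn (j - n)%N; rewrite subnKC// => /lt_trans; apply.
  by rewrite invf_plt ?posrE// truncnS_gt.
apply: ae_foralln => k; pose eps : R := k.+1%:R^-1.
have e0 : 0 < eps by rewrite invr_gt0.
pose U n := \bigcup_N hit eps n N.
have mU n : measurable (U n) by apply: bigcupT_measurable => N; exact: measurable_hit.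
have PU n : (P (U n) <= (eiter n W st0 / eps)%:E)%E.
  have nd : nondecreasing_seq (hit eps n).
    move=> N M NM; apply/subsetPset => w [j jN]; exists j => //.
    exact: leq_trans jN NM.
  have cv := @nondecreasing_cvg_mu _ _ _ P _ (measurable_hit eps n) (mU n) nd. rewrite -(cvg_lim _ cv)//; apply: lime_le.
    by apply/cvg_ex; eexists; exact: cv.
  by apply: nearW => N /=; rewrite prE ?lee_fin ?maximal//; exact: measurable_hit.
exists (\bigcap_n U n); split.
- exact: bigcapT_measurable.
- apply/eqP; rewrite eq_le measure_ge0 andbT; apply/lee_addgt0Pr => e e1.
  rewrite add0e; have [n hn] := Wsmall (eps * e) (mulr_gt0 e0 e1).
  apply: (@le_trans _ _ (P (U n))).
    by apply: le_measure; rewrite ?inE//; [exact: bigcapT_measurable|exact: bigcap_inf].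
  by apply: le_trans (PU n) _; rewrite lee_fin ler_pdivrMr// mulrC.
- move=> w /= nw n _; apply: contrapT => nU; apply: nw; exists n => j.
  rewrite ltNge; apply/negP => Wj; apply: nU; exists j => //; by exists j.
Qed.

End Chain.
End Driven.

(* Robbins-Siegmund: with [tau] the tails of the series of the [b i], the
   process [expR (tau i) * (1 + V) - 1] is a supermartingale dominating [V]. *)
Section AlmostSupermartingale.
Variables (R : realType) (S : countType) (mu : S -> R) (supp : seq S).
Hypothesis supp_uniq : uniq supp.
Hypothesis mu_sum1 : \sum_(s <- supp) mu s = 1.
Variables (d : measure_display) (Omega : measurableType d) (P : probability Omega R).
Variable X : nat -> Omega -> S.
Hypothesis HX : forall s, measurable (cyl X s) /\ P (cyl X s) = (\prod_(x <- s) mu x)%:E.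
Variables (Z : Type) (u : nat -> S -> Z -> Z) (z0 : Z) (Inv : Z -> Prop).
Hypothesis Inv0 : Inv z0.
Hypothesis InvS : forall i s z, Inv z -> Inv (u i s z).
Variables (V : Z -> R) (a b tau : nat -> R).
Hypothesis V_ge0 : forall z, Inv z -> 0 <= V z.
Hypothesis a_ge0 : forall i, 0 <= a i.
Hypothesis b_ge0 : forall i, 0 <= b i.
Hypothesis a_div : forall (M : R) m, exists k, M <= \sum_(j < k) a (m + j)%N.
Hypothesis tau_ge0 : forall i, 0 <= tau i.
Hypothesis tauS : forall i, tau i = b i + tau i.+1.
Hypothesis tau_cvg0 : forall e : R, 0 < e -> exists m, forall i, (m <= i)%N -> tau i <= e.
Hypothesis V_drift : forall i z, Inv z ->
  estep mu supp (fun s => V (u i s z)) <= (1 + b i) * V z - a i * V z + b i.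

(** Carrying the time in the state turns the time-dependent recursion [u] into a homogeneous
    chain. *)
Let upd (s : S) (st : nat * Z) : nat * Z := (st.1.+1, u st.1 s st.2).
Let st0 : nat * Z := (0%N, z0).
Let InvN (st : nat * Z) : Prop := Inv st.2.
Let W (st : nat * Z) : R := expR (tau st.1) * (1 + V st.2) - 1.

Let InvNS s st : InvN st -> InvN (upd s st).
Proof. exact: InvS. Qed.

Let V_le_W st : InvN st -> V st.2 <= W st.
Proof.
move=> /V_ge0 v0; have : 1 <= expR (tau st.1).
  by rewrite (le_trans _ (expR_ge1Dx _))// lerDl.
by rewrite /W; nra.
Qed.

(** The drift reads [1 + E V' <= (1 + b i) * (1 + V) - a i * V], and [1 + b i <= expR (b i)] is
    absorbed in passing from [tau i.+1] to [tau i]. *)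
Let W_drift st : InvN st ->
  estep mu supp (fun s => W (upd s st)) <= W st - a st.1 * V st.2.
Proof.
case: st => i z /= Iz.
have -> : (fun s => W (upd s (i, z))) =
    (fun s => expR (tau i.+1) * V (u i s z) + (expR (tau i.+1) - 1)).
  by apply/funext => s; rewrite /W /=; lra.
rewrite (estep_affine mu_sum1) /W /=.
have e1 : 1 <= expR (tau i.+1) by rewrite (le_trans _ (expR_ge1Dx _))// lerDl.
have eb := expR_ge1Dx (b i); have := V_drift i Iz; have v0 := V_ge0 Iz.
rewrite (tauS i) expRD; set EV := estep _ _ _.
have := a_ge0 i; have := b_ge0 i.
move: (expR (tau i.+1)) e1 (expR (b i)) eb => x x1 y yb bi0 ai0 EVle.
have h1 : x * (1 + EV) <= x * ((1 + b i) * (1 + V z) - a i * V z).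
  by rewrite ler_pM2l; lra.
have h2 : x * ((1 + b i) * (1 + V z)) <= x * (y * (1 + V z)).
  by rewrite ler_pM2l; [apply: ler_wpM2r; lra|lra].
have h3 : a i * V z <= x * (a i * V z) by rewrite ler_peMl// mulr_ge0.
by rewrite mulrBr in h1; lra.
Qed.

Let eiterN k f g st : InvN st ->
  (forall st', InvN st' -> st'.1 = (st.1 + k)%N -> f st' <= g st') ->
  eiter mu supp upd k f st <= eiter mu supp upd k g st.
Proof.
elim: k st => [|k IH] st Ist fg /=; first by apply: fg; rewrite ?addn0.
apply: (estep_le supp HX) => s; apply: IH; first exact: InvNS.
by move=> st' Ist' /= e; apply: fg; rewrite ?e ?addSnnS.
Qed.

Let EW n := eiter mu supp upd n W st0.
Let EV n := eiter mu supp upd n (fun st => V st.2) st0.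

Let EW_V n : EW n = expR (tau n) * EV n + (expR (tau n) - 1).
Proof.
rewrite /EW /EV -(eiter_affine mu_sum1).
by apply/eqP; rewrite eq_le; apply/andP; split; apply: eiterN => // st _;
  rewrite /W /= => ->; rewrite add0n; lra.
Qed.

Let EW_S n : EW n.+1 <= EW n - a n * EV n.
Proof.
rewrite [leLHS]/EW eiterSr.
have -> : EW n - a n * EV n =
    eiter mu supp upd n (fun st => W st - a n * V st.2) st0.
  rewrite EW_V.
  have -> : expR (tau n) * EV n + (expR (tau n) - 1) - a n * EV n =
    (expR (tau n) - a n) * EV n + (expR (tau n) - 1) by lra.
  rewrite /EV -(eiter_affine mu_sum1).
  by apply/eqP; rewrite eq_le; apply/andP; split; apply: eiterN => // st _;
    rewrite /W /= => ->; rewrite add0n; lra.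
by apply: eiterN => // st Ist; rewrite add0n => <-; exact: W_drift.
Qed.

(** If [EW] stayed above [e], then [EV] would be at least [e / 2] once [tau] is small, and [EW]
    would lose [a n * (e / 2)] at each step; the sum of the [a n] diverges. *)
Let EW_small (e : R) : 0 < e -> exists n, EW n <= e.
Proof.
move=> e0; apply: contrapT => nE.
have {nE} eE n : e < EW n.
  by rewrite ltNge; apply/negP => nE'; apply: nE; exists n.
(* This threshold gives [(1 - tau n) * (1 + e) >= 1 + e / 2], where the left side is at most
   [expR (- tau n) * (1 + e) < 1 + EV n]. *)
have [|m hm] := @tau_cvg0 (e / 2 / (1 + e)); first by rewrite !divr_gt0// addr_gt0.
have EVlb n : (m <= n)%N -> e / 2 <= EV n.
  move=> /hm; rewrite ler_pdivlMr ?addr_gt0// => tn.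
  have := eE n; rewrite EW_V => h.
  have h1 : expR (- tau n) * expR (tau n) = 1 by rewrite -expRD addNr expR0.
  have h2 := expR_ge1Dx (- tau n); have h3 := expR_gt0 (- tau n).
  have h4 : expR (- tau n) * (1 + e) < 1 + EV n.
    have : expR (- tau n) * (1 + e) <
        expR (- tau n) * (expR (tau n) * (1 + EV n)) by rewrite ltr_pM2l//; lra.
    by rewrite mulrA h1 mul1r.
  have : (1 + - tau n) * (1 + e) <= expR (- tau n) * (1 + e).
    by apply: ler_wpM2r => //; lra.
  by lra.
have dec k : EW (m + k) <= EW m - e / 2 * \sum_(j < k) a (m + j)%N.
  elim: k => [|k IH]; first by rewrite big_ord0 addn0; lra.
  rewrite addnS big_ord_recr /= (le_trans (EW_S _))//.
  have := EVlb _ (leq_addr k m); have := a_ge0 (m + k) => ak ek.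
  have : a (m + k)%N * (e / 2) <= a (m + k)%N * EV (m + k) by apply: ler_wpM2l.
  by lra.
have [k] := a_div (EW m / (e / 2)) m.
rewrite ler_pdivrMr ?divr_gt0// => hk.
have := dec k; have := eE (m + k)%N; lra.
Qed.

Lemma almost_supermartingale_cvg0 :
  {ae P, forall w, forall e : R, 0 < e -> exists n, forall j, (n <= j)%N ->
     V (foldl (fun st s => upd s st) st0 (prefix X w j)).2 < e}.
Proof.
have := supermartingale_cvg0 supp_uniq mu_sum1 HX (upd := upd) (st0 := st0)
  (Inv := InvN) Inv0 InvNS (W := W).
move=> /(_ _ _ EW_small) H; apply: filterS (H _ _).
- move=> w Hw e /Hw[n hn]; exists n => j /hn; apply: le_lt_trans.
  by apply: V_le_W; exact: (Inv_run (upd := upd) (Inv := InvN)).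
- by move=> st Ist; apply: le_trans (V_le_W Ist); exact: V_ge0.
- move=> st Ist; apply: le_trans (W_drift Ist) _; rewrite gerBl.
  by rewrite mulr_ge0// V_ge0.
Qed.

End AlmostSupermartingale.

(** * Drift of power sums *)

Section PowerDrift.
Variable R : realType.

(** Induction on [N]: the next remainder is [x + l * z] times the previous one plus an explicit term
    of order [l ^+ 2]. *)
Lemma taylor_bound (N : nat) : exists2 C : R, 0 <= C & forall x z l M : R,
  `|x| <= M -> `|z| <= M -> 0 <= l <= 1 ->
  `|(x + l * z) ^+ N - x ^+ N - N%:R * (x ^+ N.-1 * (l * z))| <= l ^+ 2 * (C * M ^+ N).
Proof.
elim: N => [|N [C C0 IH]].
  by exists 0 => // *; rewrite !expr0 mul0r subrr subr0 normr0 mul0r mulr0.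
exists (2 * C + N%:R) => [|x z l M xM zM /andP[l0 l1]]; first by rewrite addr_ge0// mulr_ge0.
have M0 : 0 <= M by apply: le_trans xM.
have := IH x z l M xM zM; rewrite l0 l1 => /(_ isT).
set r := (X in `|X| <= _) => rle.
(* At [N = 0] the truncated predecessor makes the two powers differ, but the factor [N%:R]
   vanishes. *)
have xN : N%:R * (x ^+ N.-1 * x) = N%:R * x ^+ N.
  by case: (N) => [|n]; rewrite ?mulr0n ?mul0r// -exprSr.
have -> : (x + l * z) ^+ N.+1 - x ^+ N.+1 - N.+1%:R * (x ^+ N.+1.-1 * (l * z)) =
   (x + l * z) * r + l ^+ 2 * (N%:R * x ^+ N.-1 * z ^+ 2) +
   (N%:R * (x ^+ N.-1 * x) - N%:R * x ^+ N) * (l * z).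
  by rewrite /r !exprS -natr1 /=; ring.
rewrite xN subrr mul0r addr0.
have xl : `|x + l * z| <= 2 * M.
  apply: le_trans (ler_normD _ _) _; rewrite normrM (ger0_norm l0).
  have : l * `|z| <= 1 * M by apply: ler_pM.
  by lra.
have h1 : `|(x + l * z) * r| <= 2 * M * (l ^+ 2 * (C * M ^+ N)).
  by rewrite normrM ler_pM.
have h2 : `|l ^+ 2 * (N%:R * x ^+ N.-1 * z ^+ 2)| <= l ^+ 2 * (N%:R * M ^+ N.+1).
  rewrite (normrM (l ^+ 2)) (normrX 2) (ger0_norm l0) ler_wpM2l ?exprn_ge0//.
  rewrite (normrM (_ * _)) (normrM N%:R) normr_nat !normrX.
  case: (N) => [|n]; first by rewrite !mul0r.
  rewrite -mulrA ler_wpM2l//.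
  by rewrite -(addn2 n) exprD ler_pM ?exprn_ge0// lerXn2r// nnegrE.
apply: le_trans (ler_normD _ _) _; apply: le_trans (lerD h1 h2) _.
by rewrite le_eqVlt; apply/orP; left; apply/eqP; rewrite (exprS M); ring.
Qed.

(** If [r * m <= y] the first term on the right dominates, otherwise the second. For [r < 1] the
    coefficient [r ^+ n.+2] of the second becomes small as [n] grows. *)
Lemma power_young (r m y : R) n : 0 <= r -> 0 <= m -> 0 <= y ->
  y ^+ n * (r ^+ 2 * m) <= r * y ^+ n.+1 + r ^+ n.+2 * m ^+ n.+1.
Proof.
move=> r0 m0 y0; have [rmy|yrm] := leP (r * m) y.
  apply: (@le_trans _ _ (r * y ^+ n.+1)); last by rewrite lerDl mulr_ge0 ?exprn_ge0.
  have -> : y ^+ n * (r ^+ 2 * m) = r * (y ^+ n * (r * m)) by ring.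
  rewrite (exprSr y) ler_wpM2l//.
  by rewrite ler_wpM2l ?exprn_ge0.
apply: (@le_trans _ _ (r ^+ n.+2 * m ^+ n.+1)); last first.
  by rewrite lerDr mulr_ge0 ?exprn_ge0.
apply: (@le_trans _ _ ((r * m) ^+ n * (r ^+ 2 * m))).
  by apply: ler_wpM2r; rewrite ?mulr_ge0 ?exprn_ge0// lerXn2r ?nnegrE ?mulr_ge0// ltW.
by rewrite le_eqVlt; apply/orP; left; apply/eqP; rewrite exprMn (exprSr m) -(addn2 n) exprD; ring.
Qed.

(** By [power_young], one factor [r] of the contraction stays in front of the power sum and the
    other serves to produce [r ^+ n.+2], which for [r < 1] and large [n] outweighs the number of
    coordinates. *)
Lemma power_drift (I : finType) (D : pred I) (x g : I -> R) (r m : R) n :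
  odd n -> 0 <= r -> 0 <= m -> (forall k, D k -> `|g k| <= r ^+ 2 * m) ->
  m ^+ n.+1 <= \sum_(k | D k) x k ^+ n.+1 ->
  \sum_(k | D k) x k ^+ n * (g k - x k) <=
    - (1 - r - #|D|%:R * r ^+ n.+2) * \sum_(k | D k) x k ^+ n.+1.
Proof.
move=> on r0 m0 gm mS; set Sx := \sum_(k | D k) x k ^+ n.+1.
apply: (@le_trans _ _ (\sum_(k | D k) ((r - 1) * x k ^+ n.+1 + r ^+ n.+2 * m ^+ n.+1))).
  apply: ler_sum => k Dk; have ev : ~~ odd n.+1 by rewrite /= on.
  have xe : x k ^+ n.+1 = `|x k| ^+ n.+1.
    by rewrite -normrX ger0_norm// exprn_even_ge0.
  have := power_young n r0 m0 (normr_ge0 (x k)); rewrite -xe => h.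
  have : x k ^+ n * g k <= `|x k| ^+ n * (r ^+ 2 * m).
    apply: le_trans (ler_norm _) _; rewrite normrM normrX.
    by rewrite ler_wpM2l ?exprn_ge0// gm.
  by rewrite mulrBr -exprSr; lra.
rewrite big_split /= -mulr_sumr sumr_const -/Sx -mulr_natl.
have : #|D|%:R * (r ^+ n.+2 * m ^+ n.+1) <= #|D|%:R * (r ^+ n.+2 * Sx).
  by rewrite !ler_wpM2l ?exprn_ge0.
by lra.
Qed.

Lemma max_norm (I : finType) (D : pred I) (x : I -> R) N : (0 < N)%N -> ~~ odd N ->
  exists m, [/\ 0 <= m, forall k, D k -> `|x k| <= m &
    m ^+ N <= \sum_(k | D k) x k ^+ N].
Proof.
move=> N0 eN; pose m := \big[Num.max/0]_(k | D k) `|x k|; exists m.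
have xe k : x k ^+ N = `|x k| ^+ N by rewrite -normrX ger0_norm// exprn_even_ge0.
split=> [|k Dk|]; [exact: bigmax_ge_id|exact: (le_bigmax_cond _ _ Dk)|].
have S0 : 0 <= \sum_(k | D k) x k ^+ N.
  by apply: sumr_ge0 => k _; rewrite exprn_even_ge0.
rewrite /m; elim/big_ind: _ => [|y z yS zS|k Dk].
- by rewrite expr0n eqn0Ngt N0.
- by rewrite /Num.max; case: ifP.
- rewrite -xe (bigD1 k)//= lerDl; apply: sumr_ge0 => j _.
  by rewrite exprn_even_ge0.
Qed.

Lemma exprD1_le (m : R) N : 0 <= m -> (1 + m) ^+ N <= 2 ^+ N * (1 + m ^+ N).
Proof.
move=> m0; have [m1|m1] := leP m 1.
  apply: (@le_trans _ _ (2 ^+ N)).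
    by rewrite lerXn2r ?nnegrE//; lra.
  by rewrite ler_peMr ?exprn_ge0// lerDl exprn_ge0.
apply: (@le_trans _ _ ((2 * m) ^+ N)).
  by rewrite lerXn2r ?nnegrE//; lra.
by rewrite exprMn ler_wpM2l ?exprn_ge0// lerDr.
Qed.

Lemma odd_exponent (r c : R) : 0 <= r < 1 -> 0 <= c ->
  exists2 n, odd n & c * r ^+ n.+2 <= (1 - r) / 2.
Proof.
move=> /andP[r0 r1] c0.
have rn : `|r| < 1 by rewrite ger0_norm.
have /cvgrPdist_le /(_ ((1 - r) / 2 / (1 + c))) := cvg_expr rn.
have e0 : 0 < (1 - r) / 2 / (1 + c) by rewrite !divr_gt0 ?subr_gt0//; lra.
move=> /(_ e0)[p _ /(_ p (leqnn p))].
rewrite sub0r normrN ger0_norm ?exprn_ge0// => rp.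
exists (p.*2.+1); first by rewrite /= odd_double.
have : r ^+ p.*2.+3 <= r ^+ p.
  by rewrite ler_wiXn2l// ?(ltW r1)//; rewrite -addnn -!addnS leq_addr.
move/le_trans => /(_ _ rp); rewrite ler_pdivlMr; last by lra.
by have := exprn_ge0 p.*2.+3 r0; lra.
Qed.

End PowerDrift.

(** * Drift of the Q-learning recursion *)

(** An outcome may occur in several entries of [dl]; exchanging the sums collects each entry exactly
    once, under its outcome. *)
Lemma sum_dprob (R : realType) (T : finType) (dl : seq (seq T * R)) (f : seq T -> R) :
  \sum_(b <- undup [seq x.1 | x <- dl]) dprob dl b * f b = \sum_(x <- dl) x.2 * f x.1.
Proof.
rewrite /dprob; under eq_bigr do rewrite mulr_suml big_mkcond.
rewrite exchange_big big_seq [RHS]big_seq; apply: eq_bigr => x xdl /=.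
rewrite -big_mkcond (big_rem x.1) /=; last by rewrite mem_undup map_f.
rewrite eqxx big1_seq ?addr0// => b /andP[/eqP <-].
by rewrite mem_rem_uniqF ?undup_uniq.
Qed.

Section QDrift.
Variables (R : realType) (T A : finType) (B : bmdp R T A).
Hypothesis HB : bmdp_wf B.
Variable psel : T -> A -> R.
Hypothesis Hpsum : \sum_(q : T) \sum_(a : A | enabled B q a) psel q a = 1.

Let en (k : T * A) := enabled B k.1 k.2.

(** The finite support required of the driving sequence, hence the [undup]; a pair that is not
    enabled contributes nothing. *)
Definition steps : seq (T * A * seq T) :=
  [seq (k, b) | k <- index_enum (T * A)%type,
                b <- undup [seq x.1 | x <- outs B k.1 k.2]].

Lemma steps_uniq : uniq steps.
Proof.
apply: allpairs_uniq_dep; first exact: index_enum_uniq.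
  by move=> k _; exact: undup_uniq.
by move=> [k b] [k' b'] _ _ [-> ->].
Qed.

Lemma estep_steps f : estep (stepprob B psel) steps f =
  \sum_(k : T * A | en k) psel k.1 k.2 * eout B k.1 k.2 (fun b => f (k, b)).
Proof.
rewrite /estep big_allpairs_dep [RHS]big_mkcond; apply: eq_bigr => -[q a] _ /=.
rewrite /en /enabled /eout /outs /=; case: (trans B q a) => [dl|] /=.
  rewrite -(sum_dprob dl (fun b => f (q, a, b))) mulr_sumr.
  by apply: eq_bigr => b _; rewrite mulrA.
by rewrite big_nil.
Qed.

Lemma psel_sum1 : \sum_(k : T * A | en k) psel k.1 k.2 = 1.
Proof. by rewrite -Hpsum pair_big_dep; apply: eq_bigl => -[q a]. Qed.

Lemma steps_sum1 : \sum_(s <- steps) stepprob B psel s = 1.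
Proof.
have := estep_steps (fun=> 1); rewrite /estep.
under eq_bigr do rewrite mulr1.
move=> ->; rewrite -[RHS]psel_sum1; apply: eq_bigr => k ek.
by rewrite (eout_cst HB)// mulr1.
Qed.

Variables (pmin : R) (pmin0 : 0 < pmin).
Hypothesis Hpsel : forall q a, enabled B q a -> pmin <= psel q a.

Lemma psel_gt0 k : en k -> 0 < psel k.1 k.2.
Proof. by move=> ek; apply: lt_le_trans (Hpsel ek). Qed.

Lemma psel_le1 k : en k -> psel k.1 k.2 <= 1.
Proof.
move=> ek; rewrite -psel_sum1 (bigD1 k)//= lerDl sumr_ge0// => j /andP[ej _].
exact/ltW/psel_gt0.
Qed.

Variable u : T -> R.
Hypothesis u0 : forall q, 0 <= u q.
Hypothesis uE : forall q, minQ B (Qof B u) q = u q.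

Let Qs (k : T * A) : R := Qof B u k.1 k.2.
Let c (k : T * A) : R := cost B k.1 k.2.

Lemma Qs_gt0 k : en k -> 0 < Qs k.
Proof.
move=> ek; apply: (lt_le_trans (cost_gt0 HB k.1 k.2)); rewrite /Qs /Qof lerDl.
rewrite -[leLHS](eout_cst HB 0 ek); apply: (eout_le HB) => x _.
by apply: sumr_ge0.
Qed.

(** * Relative errors and the contraction towards Q* *)

Definition nonneg (Q : T -> A -> R) := forall q a, enabled B q a -> 0 <= Q q a.

Lemma nonneg_qupdate (l : R) s Q : 0 <= l <= 1 -> nonneg Q -> nonneg (qupdate B l s Q).
Proof.
case: s => [[q a] b] /andP[l0 l1] Q0 q' a' e' /=; case: ifP => [/andP[/eqP qq /eqP aa]|_].
  apply: addr_ge0; apply: mulr_ge0 => //; first by rewrite subr_ge0.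
    by rewrite -qq -aa Q0.
  apply: addr_ge0; first exact/ltW/(cost_gt0 HB).
  apply: sumr_ge0 => r _; have [a1 e1 ->] := minQ_attained HB Q r.
  exact: Q0.
exact: Q0.
Qed.

(** In these coordinates the maximum norm weighted by Q* is the ordinary one. *)
Definition relerr (Q : T -> A -> R) (k : T * A) : R := (Q k.1 k.2 - Qs k) / Qs k.

Lemma relerr_le Q k (m : R) : en k -> `|relerr Q k| <= m -> `|Q k.1 k.2 - Qs k| <= m * Qs k.
Proof.
move=> ek; have q0 := Qs_gt0 ek.
by rewrite normrM normfV (gtr0_norm q0) ler_pdivrMr.
Qed.

(** The upper bound tests [Q] at an action optimal for Q*, the lower bound tests Q* at an action
    minimizing [Q]. *)
Lemma minQ_relerr Q (m : R) r : nonneg Q -> 0 <= m ->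
  (forall k, en k -> `|relerr Q k| <= m) -> `|minQ B Q r - u r| <= m * u r.
Proof.
move=> Q0 m0 Qm; rewrite ler_norml; apply/andP; split.
  have [a ra ->] := minQ_attained HB Q r.
  have := relerr_le (k := (r, a)) ra (Qm (r, a) ra); rewrite ler_norml /= => /andP[h _].
  have ua : u r <= Qs (r, a) by rewrite -uE; exact: minQ_le.
  (* The target is [(1 - m) * u r <= Q r a]. For [m <= 1] it follows from [u r <= Qs (r, a)]; for
     [m > 1] the left side is at most 0 and [Q] is nonnegative. *)
  have := Q0 _ _ ra; have := u0 r; case: (leP m 1) => m1 ur Qr.
    have : (1 - m) * u r <= (1 - m) * Qs (r, a) by rewrite ler_wpM2l// subr_ge0.
    by lra.
  have : 1 * u r <= m * u r by rewrite ler_wpM2r// ltW.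
  by lra.
have [a ra ha] := minQ_attained HB (Qof B u) r; rewrite uE in ha.
have := relerr_le (k := (r, a)) ra (Qm (r, a) ra); rewrite ler_norml /Qs /= -ha.
by move=> /andP[_]; have := minQ_le Q ra; lra.
Qed.

(* [min] is monotone and positively homogeneous, so the Bellman operator [G]
   satisfies [G (t Qs) - Qs = (t - 1) (Qs - c)] for [t >= 0], and [c >= dl Qs]. *)
Lemma bellman_contraction Q (m dl : R) k : nonneg Q -> 0 <= m ->
  (forall k, en k -> `|relerr Q k| <= m) -> en k -> dl * Qs k <= c k ->
  `|relerr (Qof B (minQ B Q)) k| <= (1 - dl) * m.
Proof.
move=> Q0 m0 Qm ek dk; have q0 := Qs_gt0 ek.
rewrite /relerr normrM normfV (gtr0_norm q0) ler_pdivrMr//.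
apply: (@le_trans _ _ (m * (Qs k - c k))); last first.
  have : m * (dl * Qs k) <= m * c k by rewrite ler_wpM2l.
  by lra.
have mr r := minQ_relerr r Q0 m0 Qm.
have -> : Qof B (minQ B Q) k.1 k.2 - Qs k =
    eout B k.1 k.2 (fun b => \sum_(r <- b) (minQ B Q r - u r)).
  rewrite [RHS](eq_eout _ _ _ (g := fun b =>
        \sum_(r <- b) minQ B Q r + (-1) * \sum_(r <- b) u r)).
    by rewrite eoutD eoutZ /Qs /Qof; lra.
  by move=> b; rewrite sumrB mulN1r.
have -> : m * (Qs k - c k) = eout B k.1 k.2 (fun b => m * \sum_(r <- b) u r).
  by rewrite eoutZ /Qs /Qof /c; lra.
have lb b : `|\sum_(r <- b) (minQ B Q r - u r)| <= m * \sum_(r <- b) u r.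
  apply: le_trans (ler_norm_sum _ _ _) _; rewrite mulr_sumr.
  by apply: ler_sum => r _.
rewrite ler_norml; apply/andP; split; last first.
  by apply: (eout_le HB) => x _; exact: le_trans (ler_norm _) (lb _).
rewrite -mulN1r -eoutZ; apply: (eout_le HB) => x _.
by have := lb x.1; rewrite ler_norml mulN1r => /andP[].
Qed.

(** The temporal difference for the drawn list [b], in units of Q*: an update with rate [l] moves
    [relerr Q k] by [l] times it. *)
Definition innov (Q : T -> A -> R) (k : T * A) (b : seq T) : R :=
  (c k + \sum_(r <- b) minQ B Q r - Q k.1 k.2) / Qs k.

Lemma innov_mean Q k : en k ->
  eout B k.1 k.2 (innov Q k) = relerr (Qof B (minQ B Q)) k - relerr Q k.
Proof.
move=> ek; rewrite (eq_eout _ _ _ (g := fun b => (Qs k)^-1 * (\sum_(r <- b) minQ B Q r +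
   (c k - Q k.1 k.2)))); last by move=> b; rewrite /innov mulrC; congr (_ * _); lra.
rewrite eoutZ eoutD (eout_cst HB)// /relerr /Qof /c -mulrBl mulrC.
by congr (_ / _); lra.
Qed.

Lemma innov_bound : exists2 D : R, 0 <= D & forall Q (m : R), nonneg Q -> 0 <= m ->
  (forall k, en k -> `|relerr Q k| <= m) -> forall k b, en k ->
  (exists x, x \in outs B k.1 k.2 /\ b = x.1) -> `|innov Q k b| <= D * (1 + m).
Proof.
have [n hn] := size_outs_ubound B; have [U U0 hU] := fun_ubound u.
have [c0 c00 hc] := cost_lbound HB; have [C C0 hC] := fun_ubound c.
(* The sampled target is at most [(1 + m) * (C + n%:R * U)], with [n] bounding the number of
   offspring, and [Qs k >= c0]; the summand 1 accounts for the old entry, at most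
   [(1 + m) * Qs k]. *)
exists ((C + n%:R * U) / c0 + 1) => [|Q m Q0 m0 Qm k b ek [x [xin ->]]].
  by rewrite addr_ge0// divr_ge0 ?(ltW c00)// addr_ge0 ?(ltW C0)// mulr_ge0// ltW.
have q0 := Qs_gt0 ek; have cq : c k <= Qs k.
  rewrite /Qs /Qof lerDl -[leLHS](eout_cst HB 0 ek); apply: (eout_le HB) => y _.
  by apply: sumr_ge0.
have Qb : `|Q k.1 k.2| <= (1 + m) * Qs k.
  have := relerr_le ek (Qm _ ek); rewrite !ler_norml => /andP[_ h].
  by have := Q0 _ _ ek; rewrite mulrDl mul1r; nra.
have ck : 0 < c k by exact: cost_gt0.
have Sb : `|\sum_(r <- x.1) minQ B Q r| <= (1 + m) * (n%:R * U).
  apply: le_trans (ler_norm_sum _ _ _) _.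
  apply: (@le_trans _ _ (\sum_(r <- x.1) (1 + m) * U)).
    apply: ler_sum => r _; have := minQ_relerr r Q0 m0 Qm.
    have [a ra ->] := minQ_attained HB Q r; rewrite (ger0_norm (Q0 _ _ ra)).
    rewrite ler_norml => /andP[_ h]; apply: (@le_trans _ _ ((1 + m) * u r)); first by lra.
    by rewrite ler_wpM2l ?addr_ge0.
  rewrite -mulr_sumr big_const_seq count_predT iter_addr_0 -(mulr_natl U).
  apply: ler_wpM2l; first exact: addr_ge0.
  by apply: ler_wpM2r; [exact: ltW|rewrite ler_nat; exact: hn xin].
rewrite /innov normrM normfV (gtr0_norm q0) ler_pdivrMr//.
apply: (@le_trans _ _ ((1 + m) * (C + n%:R * U) + (1 + m) * Qs k)).
  apply: le_trans (ler_normB _ _) _; apply: lerD => //.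
  apply: le_trans (ler_normD _ _) _; rewrite (gtr0_norm ck) mulrDr lerD//.
  by apply: le_trans (hC k) _; rewrite ler_peMl ?(ltW C0)// lerDl.
have -> : ((C + n%:R * U) / c0 + 1) * (1 + m) * Qs k =
   (1 + m) * ((C + n%:R * U) * (Qs k / c0)) + (1 + m) * Qs k by ring.
rewrite lerD2r ler_wpM2l ?addr_ge0// ler_peMr//.
  by rewrite addr_ge0 ?(ltW C0)// mulr_ge0// ltW.
by rewrite ler_pdivlMr// mul1r (le_trans (hc _ _) cq).
Qed.

(* The weights [1 / psel] make every coordinate contribute to the mean drift as
   if it were updated at each step. *)
Definition lyap N (Q : T -> A -> R) : R :=
  \sum_(k : T * A | en k) relerr Q k ^+ N / psel k.1 k.2.

Lemma lyap_qupdate N l k b Q : en k ->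
  lyap N (qupdate B l (k, b) Q) = lyap N Q +
   ((relerr Q k + l * innov Q k b) ^+ N - relerr Q k ^+ N) / psel k.1 k.2.
Proof.
move=> ek; rewrite /lyap (bigD1 k)//= [in RHS](bigD1 k)//=.
have -> : relerr (qupdate B l (k, b) Q) k = relerr Q k + l * innov Q k b.
  case: k ek => q a ek; rewrite /relerr /innov /qupdate /= !eqxx /= mulrA -mulrDl.
  by congr (_ / _); rewrite /c /=; lra.
rewrite (eq_bigr (fun j => relerr Q j ^+ N / psel j.1 j.2)); first by lra.
case: k {ek} => q a [q' a'] /andP[_]; rewrite xpair_eqE /relerr /= => /negbTE ->.
by [].
Qed.

Lemma lyap_drift : exists N, [/\ (0 < N)%N, ~~ odd N & exists2 al : R, 0 < al &
  exists2 be : R, 0 <= be & forall (l : R) Q, 0 <= l <= 1 -> nonneg Q ->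
    estep (stepprob B psel) steps (fun s => lyap N (qupdate B l s Q)) <=
    (1 + be * l ^+ 2) * lyap N Q - al * l * lyap N Q + be * l ^+ 2].
Proof.
have [c0 c00 hc] := cost_lbound HB; have [Cq Cq0 hq] := fun_ubound Qs.
(* Costs are at least [c0] and Q* at most [Cq], so [dl * Qs k <= c k]; the cap 1 keeps [1 - dl / 2]
   nonnegative. *)
pose dl := Num.min (c0 / Cq) 1.
have dl0 : 0 < dl by rewrite lt_min ltr01 andbT divr_gt0.
have dl1 : dl <= 1 by rewrite ge_min lexx orbT.
have hdl k : dl * Qs k <= c k.
  apply: (@le_trans _ _ (dl * Cq)); first by rewrite ler_wpM2l// ltW.
  apply: le_trans (hc k.1 k.2).
  by rewrite -ler_pdivlMr// ge_min lexx.
(* Chosen so that [1 - dl <= r ^+ 2], the form of contraction that [power_drift] takes, with [r]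
   still below 1. *)
pose r := 1 - dl / 2.
have r01 : 0 <= r < 1 by rewrite /r; apply/andP; split; lra.
have rdl : 1 - dl <= r ^+ 2 by rewrite /r; nra.
have [n on hn] := @odd_exponent _ r #|[pred k | en k]|%:R r01 (ler0n _ _).
have [C C0 hC] := taylor_bound R n.+1.
have [D D0 hD] := innov_bound.
pose card : R := #|[pred k | en k]|%:R.
exists n.+1; split => //; first by rewrite /= on.
have r1 : 0 < 1 - r by rewrite /r; lra.
exists (n.+1%:R * ((1 - r) / 2) * pmin); first by rewrite !mulr_gt0// divr_gt0.
pose be := card * (C * ((D + 2) ^+ n.+1 * 2 ^+ n.+1)).
exists be; first by rewrite !mulr_ge0// exprn_ge0// addr_ge0.
move=> l Q /[dup] hl /andP[l0 l1] Q0.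
have ev : ~~ odd n.+1 by rewrite /= on.
have [m [m0 xm mS]] := @max_norm _ _ [pred k | en k] (relerr Q) n.+1 isT ev.
set S := \sum_(k | _) _ in mS.
have S0 : 0 <= S by apply: le_trans mS; exact: exprn_ge0.
have Vge : S <= lyap n.+1 Q.
  apply: ler_sum => k ek; rewrite ler_peMr ?exprn_even_ge0//.
  by rewrite invf_ge1 ?psel_le1// psel_gt0.
have Vle : pmin * lyap n.+1 Q <= S.
  rewrite mulr_sumr; apply: ler_sum => k ek.
  rewrite mulrCA ler_piMr ?exprn_even_ge0//.
  by rewrite ler_pdivrMr ?psel_gt0// mul1r Hpsel.
(* One bound for both the errors and the innovations, as [taylor_bound] asks. *)
pose M := (D + 2) * (1 + m).
have xM k : en k -> `|relerr Q k| <= M.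
  by move=> /xm /le_trans; apply; rewrite /M; nra.
have zM k x : en k -> x \in outs B k.1 k.2 -> `|innov Q k x.1| <= M.
  move=> ek xin; apply: le_trans (hD Q m Q0 m0 xm k x.1 ek _) _; first by exists x.
  by rewrite /M; nra.
rewrite estep_steps.
(* [G k] bounds the expected increment due to selecting [k]: Taylor expansion with [innov] replaced
   by its mean, [psel] having cancelled against the weight in [lyap]. *)
pose G k := n.+1%:R * l * (relerr Q k ^+ n * (relerr (Qof B (minQ B Q)) k - relerr Q k))
   + l ^+ 2 * (C * M ^+ n.+1).
have Gk k : en k -> psel k.1 k.2 * eout B k.1 k.2
     (fun b => lyap n.+1 (qupdate B l (k, b) Q)) <=
   psel k.1 k.2 * lyap n.+1 Q + G k.
  move=> ek; have p0 := psel_gt0 ek.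
  rewrite -(eout_cst HB (psel k.1 k.2 * lyap n.+1 Q) ek) /G.
  rewrite -innov_mean// -eoutZ -(eout_cst HB (l ^+ 2 * _) ek) -eoutZ -eoutZ -!eoutD.
  apply: (eout_le HB) => x xin; rewrite lyap_qupdate// mulrDr [in leLHS]mulrCA divff ?gt_eqF// mulr1.
  rewrite lerD2l; have := hC _ _ _ _ (xM k ek) (zM k x ek xin) hl.
  rewrite ler_norml => /andP[_]; rewrite /= -mulr_natl.
  by lra.
apply: le_trans (ler_sum _ Gk) _.
rewrite big_split /= -mulr_suml psel_sum1 mul1r.
rewrite big_split /= -mulr_sumr sumr_const -mulr_natl -/card.
have gm k : en k -> `|relerr (Qof B (minQ B Q)) k| <= r ^+ 2 * m.
  move=> ek; apply: le_trans (bellman_contraction Q0 m0 xm ek (hdl k)) _.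
  by rewrite ler_wpM2r.
have r0 : 0 <= r by case/andP: r01.
have := @power_drift _ _ [pred k | en k] (relerr Q) _ r m n on r0 m0 gm mS.
rewrite -/S /= -/card => drift.
have h1 : n.+1%:R * l * \sum_(k | en k) relerr Q k ^+ n *
    (relerr (Qof B (minQ B Q)) k - relerr Q k) <=
    n.+1%:R * l * (- ((1 - r) / 2) * (pmin * lyap n.+1 Q)).
  rewrite ler_wpM2l ?mulr_ge0//; apply: le_trans drift _.
  have : (1 - r) / 2 * S <= (1 - r - card * r ^+ n.+2) * S.
    by rewrite ler_wpM2r//; move: hn; rewrite -/card; lra.
  have : (1 - r) / 2 * (pmin * lyap n.+1 Q) <= (1 - r) / 2 * S.
    by rewrite ler_wpM2l// divr_ge0// ltW.
  by lra.
have h2 : M ^+ n.+1 <= (D + 2) ^+ n.+1 * 2 ^+ n.+1 * (1 + lyap n.+1 Q).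
  rewrite /M exprMn -mulrA ler_wpM2l ?exprn_ge0 ?addr_ge0//.
  apply: le_trans (exprD1_le _ m0) _; rewrite ler_wpM2l ?exprn_ge0//.
  by rewrite lerD2l (le_trans mS).
have h3 : card * (l ^+ 2 * (C * M ^+ n.+1)) <= be * l ^+ 2 * (1 + lyap n.+1 Q).
  rewrite /be; have -> : card * (C * ((D + 2) ^+ n.+1 * 2 ^+ n.+1)) * l ^+ 2 * (1 + lyap n.+1 Q)
    = card * (l ^+ 2 * (C * ((D + 2) ^+ n.+1 * 2 ^+ n.+1 * (1 + lyap n.+1 Q)))) by ring.
  by rewrite ler_wpM2l// ler_wpM2l ?exprn_ge0// ler_wpM2l.
by lra.
Qed.

Lemma lyap_ge0 N Q : ~~ odd N -> 0 <= lyap N Q.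
Proof.
move=> eN; apply: sumr_ge0 => k ek; rewrite divr_ge0 ?exprn_even_ge0//.
exact/ltW/psel_gt0.
Qed.

Lemma relerr_lt N Q (e : R) k : (0 < N)%N -> ~~ odd N -> 0 <= e -> en k ->
  lyap N Q < e ^+ N -> `|relerr Q k| < e.
Proof.
move=> N0 eN e0 ek; rewrite [ltLHS](bigD1 k)//=.
have : 0 <= \sum_(j | en j && (j != k)) relerr Q j ^+ N / psel j.1 j.2.
  apply: sumr_ge0 => j /andP[ej _]; rewrite divr_ge0 ?exprn_even_ge0//.
  exact/ltW/psel_gt0.
have : relerr Q k ^+ N <= relerr Q k ^+ N / psel k.1 k.2.
  by rewrite ler_peMr ?exprn_even_ge0// invf_ge1 ?psel_le1// psel_gt0.
move=> h1 h2 h3; have : `|relerr Q k| ^+ N < e ^+ N.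
  by rewrite -normrX ger0_norm ?exprn_even_ge0//; lra.
by rewrite ltr_pXn2r.
Qed.

End QDrift.

(** * Step sizes and the theorem *)

Section Series.
Variables (R : realType) (f : nat -> R).
Hypothesis f0 : forall i, 0 <= f i.

Let cvgS : cvgn (fun n => \sum_(0 <= i < n) (f i)%:E)%E.
Proof. by apply: is_cvg_nneseries => n _ _; rewrite lee_fin. Qed.

(** Otherwise every partial sum would be at most the sum of the first [m] terms plus [M]. *)
Lemma nneseries_tail_unbounded : (\sum_(0 <= i <oo) (f i)%:E = +oo)%E ->
  forall (M : R) m, exists k, M <= \sum_(j < k) f (m + j)%N.
Proof.
move=> fy M m; apply: contrapT => nk.
have {nk} kM k : \sum_(j < k) f (m + j)%N < M.
  by rewrite ltNge; apply/negP => h; apply: nk; exists k.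
suff : (\sum_(0 <= i <oo) (f i)%:E <= (\sum_(0 <= i < m) f i + M)%:E)%E.
  by rewrite fy leye_eq.
apply: lime_le; first exact: cvgS.
apply: nearW => n; rewrite sumEFin lee_fin.
apply: (@le_trans _ _ (\sum_(0 <= i < m + n) f i)).
  by rewrite [leRHS](big_cat_nat (leq0n n) (leq_addl m n))/= lerDl sumr_ge0.
rewrite (big_cat_nat (leq0n m) (leq_addr n m))/= lerD2l.
rewrite -{1}[m]add0n big_addn addKn big_mkord.
by under eq_bigr do rewrite addnC; exact/ltW.
Qed.

Lemma nneseries_tail : (\sum_(0 <= i <oo) (f i)%:E < +oo)%E ->
  exists tau : nat -> R, [/\ forall i, 0 <= tau i,
    forall i, tau i = f i + tau i.+1 &
    forall e : R, 0 < e -> exists m, forall i, (m <= i)%N -> tau i <= e].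
Proof.
move=> foo; set L := (\sum_(0 <= i <oo) _)%E in foo.
have L0 : (0 <= L)%E by apply: nneseries_ge0 => n _ _; rewrite lee_fin.
have LE : L = (fine L)%:E by rewrite fineK// ge0_fin_numE.
have cv : (fun n => \sum_(0 <= i < n) f i) @ \oo --> (fine L : R).
  suff /fine_cvgP[_] :
    (fun n => (\sum_(0 <= i < n) f i)%:E) @ \oo --> (fine L)%:E by [].
  by rewrite -LE; under eq_fun do rewrite -sumEFin; exact: cvgS.
have nd : nondecreasing_seq (fun n => \sum_(0 <= i < n) f i).
  by apply/nondecreasing_seqP => n; rewrite big_nat_recr//= lerDl.
exists (fun n => fine L - \sum_(0 <= i < n) f i); split => [i|i|e e0].
- rewrite subr_ge0 -(cvg_lim _ cv)//.
  by apply: nondecreasing_cvgn_le => //; apply/cvg_ex; eexists; exact: cv.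
- by rewrite big_nat_recr//=; lra.
- have /cvgrPdist_le /(_ e e0) [m _ hm] := cv.
  by exists m => i /hm; apply: le_trans; exact: ler_norm.
Qed.

End Series.

Theorem theorem6 (R : realType) (T A : finType) (B : bmdp R T A)
  (HB : bmdp_wf B)
  (HQfin : forall q a, enabled B q a -> (Qstar B q a < +oo)%E)
  (lam : nat -> R) (Hlam : forall i, 0 <= lam i <= 1)
  (Hdiv : (\sum_(0 <= i <oo) (lam i)%:E = +oo)%E)
  (Hsq : (\sum_(0 <= i <oo) ((lam i) ^+ 2)%:E < +oo)%E)
  (psel : T -> A -> R) (pmin : R) (Hpmin : 0 < pmin)
  (Hpsel : forall q a, enabled B q a -> pmin <= psel q a)
  (Hpsum : \sum_(q : T) \sum_(a : A | enabled B q a) psel q a = 1)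
  (d : measure_display) (Omega : measurableType d) (P : probability Omega R)
  (X : nat -> Omega -> step T A) (HX : qlearning_law B psel P X)
  (Q0 : T -> A -> R) (HQ0 : forall q a, enabled B q a -> 0 <= Q0 q a) :
  {ae P, forall w,
     (forall q a, enabled B q a ->
        (fun i => (qproc B lam Q0 (fun j => X j w) i q a)%:E) @ \oo
          --> Qstar B q a) /\
     (forall q,
        (fun i => (minQ B (qproc B lam Q0 (fun j => X j w) i) q)%:E) @ \oo
          --> cstar B q)}.

Proof.
have [u [u0 cE QE uE]] := bellman HB HQfin.
have [N [N0 evN [al al0 [be be0 drift]]]] :=
  lyap_drift HB Hpsum Hpmin Hpsel u0 uE.
have lam0 i : 0 <= lam i by case/andP: (Hlam i).
pose V := lyap B psel u N.
pose mu : T * A * seq T -> R := stepprob B psel.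
have HX' s : measurable (cyl X s) /\ P (cyl X s) = (\prod_(x <- s) mu x)%:E := HX s.
have lam20 i : 0 <= lam i ^+ 2 by rewrite exprn_ge0.
have [tau [tau0 tauS tauc]] := nneseries_tail lam20 Hsq.
have tauc' e : 0 < e -> exists m, forall i, (m <= i)%N -> be * tau i <= e.
  move=> e0; have [|m hm] := tauc (e / (1 + be)); first by rewrite divr_gt0//; lra.
  exists m => i /hm; rewrite ler_pdivlMr; last by lra.
  by have := tau0 i; lra.
have adiv M m : exists k, M <= \sum_(j < k) al * lam (m + j)%N.
  have [k hk] := nneseries_tail_unbounded lam0 Hdiv (M / al) m.
  by exists k; rewrite -mulr_sumr mulrC -ler_pdivrMr.
have := @almost_supermartingale_cvg0 R _ mu (steps B) (steps_uniq B)
  (steps_sum1 HB Hpsum) _ _ P X HX' (T -> A -> R)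
  (fun i s Q => qupdate B (lam i) s Q) Q0 (nonneg B) HQ0
  (fun i s Q => @nonneg_qupdate _ _ _ _ HB _ s Q (Hlam i)) V
  (fun i => al * lam i) (fun i => be * lam i ^+ 2) (fun i => be * tau i).
move=> H; apply: filterS (H _ _ _ adiv _ _ tauc' _).
- move=> w Vw.
  have runE n : foldl (fun st s => (st.1.+1, qupdate B (lam st.1) s st.2)) (0%N, Q0)
      (prefix X w n) = (n, qproc B lam Q0 (fun j => X j w) n).
    elim: n => // n IH; rewrite prefixS -cats1 foldl_cat IH /=.
    by [].
  have small e : 0 < e -> exists n, forall j, (n <= j)%N -> forall k,
      enabled B k.1 k.2 ->
      `|relerr B u (qproc B lam Q0 (fun i => X i w) j) k| <= e.
    move=> e0; have [n hn] := Vw _ (exprn_gt0 N e0).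
    exists n => j /hn; rewrite runE => Vj k ek.
    by apply: ltW; exact: (relerr_lt Hpsum Hpmin Hpsel N0 evN (ltW e0) ek Vj).
  have nnQ j : nonneg B (qproc B lam Q0 (fun i => X i w) j).
    by elim: j => // j IH; exact: nonneg_qupdate.
  (* The errors are relative to the limit; applying the bound with [e / (1 + l)] makes them absolute
     and also covers [l = 0]. *)
  have cvgE (g : nat -> R) l : (forall e : R, 0 < e -> exists n, forall j, (n <= j)%N ->
      `|g j - l| <= e * l) -> 0 <= l -> (fun i => (g i)%:E) @ \oo --> l%:E.
    move=> gl l0; apply/fine_cvgP; split; first exact: nearW.
    apply/cvgrPdist_le => e e0.
    have [|n hn] := gl (e / (1 + l)); first by rewrite divr_gt0//; lra.
    exists n => // j /= /hn; rewrite distrC => /le_trans; apply.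
    by rewrite mulrAC ler_pdivrMr; nra.
  split=> [q a qa|q].
    rewrite QE//; apply: cvgE; last first.
      by apply: ltW; exact: (Qs_gt0 HB u0 (k := (q, a)) qa).
    move=> e /small[n hn]; exists n => j /hn /(_ (q, a) qa).
    exact: (relerr_le HB u0 (k := (q, a))).
  rewrite cE; apply: cvgE => // e e0; have [n hn] := small e e0.
  exists n => j /hn hj; exact: (minQ_relerr HB u0 uE q (nnQ j) (ltW e0) hj).
- by move=> Q _; exact: (lyap_ge0 Hpmin Hpsel).
- by move=> i; rewrite mulr_ge0// ltW.
- by move=> i; rewrite mulr_ge0.
- by move=> i; rewrite mulr_ge0.
- by move=> i; rewrite tauS mulrDr.
- by move=> i Q; exact: drift.
Qed.
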